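(* Let $d\geq 1$ be an odd integer and let $k_0,k_1,k_2,k_3$ be nonzero scalars in $\mathbb{F}$ with $k_0^2=q^{-d-1}$. Then there exists a $(d+1)$-dimensional $\mathfrak{H}_q$-module $E(k_0,k_1,k_2,k_3)$ satisfying the following conditions: (i) There exists an $\mathbb{F}$-basis $\{v_i\}_{i=0}^d$ for $E(k_0,k_1,k_2,k_3)$ such that - $t_0v_i=k_0^{-1}q^{-i}(1-q^i)(1-k_0^2q^i)v_{i-1}+(k_0+k_0^{-1}-k_0^{-1}q^{-i})v_i$ for $i=2,4,\ldots,d-1$; $t_0v_i=k_0^{-1}q^{-i-1}(v_i-v_{i+1})$ for $i=1,3,\ldots,d-2$; $t_0v_0=k_0v_0$; $t_0v_d=k_0v_d$; - $t_1v_i=-k_1(1-q^i)(1-k_0^2q^i)v_{i-1}+k_1v_i+k_1^{-1}v_{i+1}$ for $i=2,4,\ldots,d-1$; $t_1v_i=k_1^{-1}v_i$ for $i=1,3,\ldots,d$; $t_1v_0=k_1v_0+k_1^{-1}v_1$; - $t_2v_i=k_0^{-1}k_1^{-1}k_3^{-1}q^{-i-1}(v_i-v_{i+1})$ for $i=0,2,\ldots,d-1$; $t_2v_i=\frac{(k_0k_1k_3q^i-k_2)(k_0k_1k_3q^i-k_2^{-1})}{k_0k_1k_3q^i}v_{i-1}+(k_2+k_2^{-1}-k_0^{-1}k_1^{-1}k_3^{-1}q^{-i})v_i$ for $i=1,3,\ldots,d$; - $t_3v_i=k_3v_i$ for $i=0,2,\ldots,d-1$; $t_3v_i=-k_3^{-1}(k_0k_1k_3q^i-k_2)(k_0k_1k_3q^i-k_2^{-1})v_{i-1}+k_3^{-1}v_i+k_3v_{i+1}$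 for $i=1,3,\ldots,d-2$; $t_3v_d=-k_3^{-1}(k_0k_1k_3q^d-k_2)(k_0k_1k_3q^d-k_2^{-1})v_{d-1}+k_3^{-1}v_d$. (ii) The elements $c_0,c_1,c_2,c_3$ act on $E(k_0,k_1,k_2,k_3)$ as scalar multiplication by $k_0+k_0^{-1}$, $k_1+k_1^{-1}$, $k_2+k_2^{-1}$, $k_3+k_3^{-1}$ respectively.
   Context: $\mathbb{F}$ is a field and $q\in\mathbb{F}$ is nonzero. The universal DAHA $\mathfrak{H}_q$ of type $(C_1^\vee,C_1)$ is the unital associative $\mathbb{F}$-algebra with generators $t_0^{\pm1},t_1^{\pm1},t_2^{\pm1},t_3^{\pm1}$ and relations: $t_it_i^{-1}=t_i^{-1}t_i=1$ for all $i$; $t_i+t_i^{-1}$ is central for all $i$; $t_0t_1t_2t_3=q^{-1}$. Put $c_i=t_i+t_i^{-1}$ for $i=0,1,2,3$. *)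

(* Defs.v *)
From HB Require Import structures.
From mathcomp Require Import all_boot all_algebra.
From mathcomp Require Import boolp.

Set Implicit Arguments.
Unset Strict Implicit.
Unset Printing Implicit Defensive.

Import GRing.Theory.
Local Open Scope ring_scope.
Local Open Scope quotient_scope.

(* The universal DAHA of type (C_1^v, C_1) is presented literally by generators
   and relations: formal algebra expressions in the letters t_i, t_i^-1, modulo
   the least congruence containing the axioms of unital associative F-algebras
   and the defining relations. *)

Inductive dexpr (F : Type) : Type :=
| DConst of F
| DGen of 'I_4
| DInv of 'I_4
| DAdd of dexpr F & dexpr F
| DMul of dexpr F & dexpr F.

Arguments DGen {F} i.
Arguments DInv {F} i.

HB.instance Definition _ (F : Type) := gen_eqMixin (dexpr F).
HB.instance Definition _ (F : Type) := gen_choiceMixin (dexpr F).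

Inductive dcong (F : fieldType) (q : F) : dexpr F -> dexpr F -> Prop :=
| DCrefl x : dcong q x x
| DCsym x y : dcong q x y -> dcong q y x
| DCtrans x y z : dcong q x y -> dcong q y z -> dcong q x z
| DCadd x x' y y' :
    dcong q x x' -> dcong q y y' -> dcong q (DAdd x y) (DAdd x' y')
| DCmul x x' y y' :
    dcong q x x' -> dcong q y y' -> dcong q (DMul x y) (DMul x' y')
(* Scalars are the DConst a, acting by DMul. *)
| DCaddA x y z : dcong q (DAdd x (DAdd y z)) (DAdd (DAdd x y) z)
| DCaddC x y : dcong q (DAdd x y) (DAdd y x)
| DCadd0 x : dcong q (DAdd (DConst 0) x) x
| DCaddN x : dcong q (DAdd (DMul (DConst (-1)) x) x) (DConst 0)
| DCmulA x y z : dcong q (DMul x (DMul y z)) (DMul (DMul x y) z)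
| DCmul1l x : dcong q (DMul (DConst 1) x) x
| DCmul1r x : dcong q (DMul x (DConst 1)) x
| DCmulDl x y z : dcong q (DMul (DAdd x y) z) (DAdd (DMul x z) (DMul y z))
| DCmulDr x y z : dcong q (DMul x (DAdd y z)) (DAdd (DMul x y) (DMul x z))
| DCconstD a b : dcong q (DConst (a + b)) (DAdd (DConst a) (DConst b))
| DCconstM a b : dcong q (DConst (a * b)) (DMul (DConst a) (DConst b))
| DCconstC a x : dcong q (DMul (DConst a) x) (DMul x (DConst a))
| DCgenV i : dcong q (DMul (DGen i) (DInv i)) (DConst 1)
| DCgenVl i : dcong q (DMul (DInv i) (DGen i)) (DConst 1)
| DCcentral i x :
    dcong q (DMul (DAdd (DGen i) (DInv i)) x) (DMul x (DAdd (DGen i) (DInv i)))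
| DCprod :
    dcong q (DMul (DMul (DMul (DGen 0) (DGen 1)) (DGen 2%:R)) (DGen 3%:R))
            (DConst q^-1).

Definition dcongb (F : fieldType) (q : F) : rel (dexpr F) :=
  fun x y => `[< dcong q x y >].

Section DcongEquiv.
Variables (F : fieldType) (q : F).

Fact dcongb_refl : reflexive (dcongb q).
Proof. by move=> x; apply/asboolP/DCrefl. Qed.

Fact dcongb_sym : symmetric (dcongb q).
Proof.
by move=> x y; apply/idP/idP => /asboolP h; apply/asboolP/DCsym.
Qed.

Fact dcongb_trans : transitive (dcongb q).
Proof.
by move=> y x z /asboolP h /asboolP h'; apply/asboolP/(DCtrans h h').
Qed.

Canonical dcong_equiv :=
  EquivRel (dcongb q) dcongb_refl dcongb_sym dcongb_trans.

End DcongEquiv.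

(* The hypothesis q != 0 is carried by the type because lalgType and algType
   only cover nontrivial algebras, and the presented algebra is 0 for q = 0. *)
Definition daha (F : fieldType) (q : F) (q0 : q != 0) : Type :=
  {eq_quot (dcong_equiv q)}.

HB.instance Definition _ (F : fieldType) (q : F) (q0 : q != 0) :=
  EqQuotient.on (daha q0).
HB.instance Definition _ (F : fieldType) (q : F) (q0 : q != 0) :=
  Choice.on (daha q0).

Fixpoint deval (F : fieldType) (A : algType F) (t s : 'I_4 -> A)
    (x : dexpr F) : A :=
  match x with
  | DConst a => a%:A
  | DGen i => t i
  | DInv i => s i
  | DAdd x y => deval t s x + deval t s y
  | DMul x y => deval t s x * deval t s y
  end.

Definition daha_relations (F : fieldType) (q : F) (A : algType F)
    (t s : 'I_4 -> A) : Prop :=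
  [/\ forall i, t i * s i = 1,
      forall i, s i * t i = 1,
      forall i x, (t i + s i) * x = x * (t i + s i)
    & t 0 * t 1 * t 2%:R * t 3%:R = (q^-1)%:A].

(* Centrality is only required against the generators; it then holds against
   every value of an expression. *)
Lemma deval_central (F : fieldType) (A : algType F) (t s : 'I_4 -> A) (c : A) :
  (forall i, c * t i = t i * c) -> (forall i, c * s i = s i * c) ->
  forall x, c * deval t s x = deval t s x * c.
Proof.
move=> ct cs; elim=> [a|i|i|x IHx y IHy|x IHx y IHy] //=.
- by rewrite -scalerAl -scalerAr mul1r mulr1.
- by rewrite mulrDl mulrDr IHx IHy.
- by rewrite mulrA IHx -mulrA IHy mulrA.
Qed.

Lemma deval_cong (F : fieldType) (q : F) (A : algType F) (t s : 'I_4 -> A) :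
  (forall i, t i * s i = 1) -> (forall i, s i * t i = 1) ->
  (forall i j, (t i + s i) * t j = t j * (t i + s i)) ->
  t 0 * t 1 * t 2%:R * t 3%:R = (q^-1)%:A ->
  forall x y, dcong q x y -> deval t s x = deval t s y.
Proof.
move=> ts st tc tp x y; elim=> {x y} /=.
- by [].
- by [].
- by move=> x y z _ -> _ ->.
- by move=> x x' y y' _ -> _ ->.
- by move=> x x' y y' _ -> _ ->.
- by move=> *; rewrite addrA.
- by move=> *; rewrite addrC.
- by move=> *; rewrite scale0r add0r.
- by move=> *; rewrite scaleN1r mulN1r addNr scale0r.
- by move=> *; rewrite mulrA.
- by move=> *; rewrite scale1r mul1r.
- by move=> *; rewrite scale1r mulr1.
- by move=> *; rewrite mulrDl.
- by move=> *; rewrite mulrDr.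
- by move=> *; rewrite scalerDl.
- by move=> *; rewrite -scalerAl mul1r scalerA.
- by move=> *; rewrite -scalerAl -scalerAr mul1r mulr1.
- by move=> *; rewrite scale1r.
- by move=> *; rewrite scale1r.
- move=> i x; apply: deval_central => // j.
  have sc : (t i + s i) * s j = s j * t j * (t i + s i) * s j.
    by rewrite st mul1r.
  by rewrite sc -(mulrA (s j)) -tc -!mulrA ts mulr1.
- by [].
Qed.

Section DahaAlgebra.
Variables (F : fieldType) (q : F) (q0 : q != 0).
Local Notation H := (daha q0).

Definition daha_const (a : F) : H := \pi_H (DConst a).
Definition daha_add (x y : H) : H := \pi_H (DAdd (repr x) (repr y)).
Definition daha_mul (x y : H) : H := \pi_H (DMul (repr x) (repr y)).
Definition daha_opp (x : H) : H := daha_mul (daha_const (-1)) x.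

Lemma daha_eqP (x y : dexpr F) : dcong q x y <-> \pi_H x = \pi_H y.
Proof.
split=> [h|]; first by apply/eqmodP/asboolP.
by move/eqmodP/asboolP.
Qed.

Lemma daha_repr (x : dexpr F) : dcong q (repr (\pi_H x)) x.
Proof. by apply/daha_eqP; rewrite reprK. Qed.

Lemma daha_addE x y : daha_add (\pi_H x) (\pi_H y) = \pi_H (DAdd x y).
Proof. by apply/daha_eqP/DCadd; apply: daha_repr. Qed.

Lemma daha_mulE x y : daha_mul (\pi_H x) (\pi_H y) = \pi_H (DMul x y).
Proof. by apply/daha_eqP/DCmul; apply: daha_repr. Qed.

Fact daha_addA : associative daha_add.
Proof.
elim/quotW=> x; elim/quotW=> y; elim/quotW=> z.
rewrite (daha_addE y z) (daha_addE x y) !daha_addE.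
exact/daha_eqP/DCaddA.
Qed.

Fact daha_addC : commutative daha_add.
Proof.
elim/quotW=> x; elim/quotW=> y.
by rewrite !daha_addE; apply/daha_eqP/DCaddC.
Qed.

Fact daha_add0 : left_id (daha_const 0) daha_add.
Proof. by elim/quotW=> x; rewrite daha_addE; apply/daha_eqP/DCadd0. Qed.

Fact daha_addN : left_inverse (daha_const 0) daha_opp daha_add.
Proof.
elim/quotW=> x; rewrite /daha_opp /daha_const daha_mulE daha_addE.
exact/daha_eqP/DCaddN.
Qed.

Fact daha_mulA : associative daha_mul.
Proof.
elim/quotW=> x; elim/quotW=> y; elim/quotW=> z.
rewrite (daha_mulE y z) (daha_mulE x y) !daha_mulE.
exact/daha_eqP/DCmulA.
Qed.

Fact daha_mul1l : left_id (daha_const 1) daha_mul.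
Proof. by elim/quotW=> x; rewrite daha_mulE; apply/daha_eqP/DCmul1l. Qed.

Fact daha_mul1r : right_id (daha_const 1) daha_mul.
Proof. by elim/quotW=> x; rewrite daha_mulE; apply/daha_eqP/DCmul1r. Qed.

Fact daha_mulDl : left_distributive daha_mul daha_add.
Proof.
elim/quotW=> x; elim/quotW=> y; elim/quotW=> z.
rewrite (daha_addE x y) (daha_mulE x z) (daha_mulE y z) daha_mulE daha_addE.
exact/daha_eqP/DCmulDl.
Qed.

Fact daha_mulDr : right_distributive daha_mul daha_add.
Proof.
elim/quotW=> x; elim/quotW=> y; elim/quotW=> z.
rewrite (daha_addE y z) (daha_mulE x y) (daha_mulE x z) daha_mulE daha_addE.
exact/daha_eqP/DCmulDr.
Qed.

(* Nontriviality: t_0 |-> q^-1, t_1, t_2, t_3 |-> 1 is a character. *)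
Fact daha_oner_neq0 : daha_const 1 != daha_const 0.
Proof.
pose t (i : 'I_4) : F^o := if i == 0 then q^-1 else 1.
have t0 i : t i != 0 by rewrite /t; case: ifP; rewrite ?invr_eq0 ?oner_eq0.
apply/eqP => /daha_eqP.
move/(@deval_cong F q F^o t (fun i => (t i : F)^-1)) => /= h.
have {}h : (1 : F)%:A = (0 : F)%:A :> F^o.
  apply: h => [i|i|i j|].
  - exact: mulfV.
  - exact: mulVf.
  - exact: (mulrC (_ : F)).
  - by rewrite /t /= !mulr1; apply/esym/(mulr1 (_ : F)).
move: h; rewrite scale1r scale0r => h.
by have := oner_neq0 F; rewrite h eqxx.
Qed.

HB.instance Definition _ := GRing.isNzRing.Build H
  daha_addA daha_addC daha_add0 daha_addN daha_mulA daha_mul1l daha_mul1r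
  daha_mulDl daha_mulDr daha_oner_neq0.

Definition daha_scale (a : F) (x : H) : H := daha_const a * x.

Fact daha_constD a b : daha_const (a + b) = daha_const a + daha_const b.
Proof. by rewrite [RHS]daha_addE; apply/daha_eqP/DCconstD. Qed.
Fact daha_constM a b : daha_const (a * b) = daha_const a * daha_const b.
Proof. by rewrite [RHS]daha_mulE; apply/daha_eqP/DCconstM. Qed.
Fact daha_constC a (x : H) : daha_const a * x = x * daha_const a.
Proof.
by rewrite -[x]reprK [LHS]daha_mulE [RHS]daha_mulE; apply/daha_eqP/DCconstC.
Qed.

Fact daha_scaleA a b x : daha_scale a (daha_scale b x) = daha_scale (a * b) x.
Proof. by rewrite /daha_scale daha_constM mulrA. Qed.
Fact daha_scale1 : left_id 1 daha_scale.
Proof. exact: mul1r. Qed.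
Fact daha_scaleDr : right_distributive daha_scale +%R.
Proof. by move=> a x y; rewrite /daha_scale mulrDr. Qed.
Fact daha_scaleDl x : {morph daha_scale^~ x : a b / a + b}.
Proof. by move=> a b; rewrite /daha_scale daha_constD mulrDl. Qed.

HB.instance Definition _ := GRing.Zmodule_isLmodule.Build F H
  daha_scaleA daha_scale1 daha_scaleDr daha_scaleDl.

Fact daha_scaleAl (a : F) (x y : H) : a *: (x * y) = (a *: x) * y.
Proof. exact: mulrA. Qed.

HB.instance Definition _ := GRing.Lmodule_isLalgebra.Build F H daha_scaleAl.

Fact daha_scaleAr (a : F) (x y : H) : a *: (x * y) = x * (a *: y).
Proof.
change (daha_const a * (x * y) = x * (daha_const a * y)).
by rewrite mulrA daha_constC mulrA.
Qed.

HB.instance Definition _ := GRing.Lalgebra_isAlgebra.Build F H daha_scaleAr.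

Definition daha_t (i : 'I_4) : H := \pi_H (DGen i).
Definition daha_tV (i : 'I_4) : H := \pi_H (DInv i).
Definition daha_c (i : 'I_4) : H := daha_t i + daha_tV i.

Lemma daha_constE a : \pi_H (DConst a) = a%:A.
Proof. exact/esym/(@mulr1 H). Qed.

Lemma daha_presentation : daha_relations q daha_t daha_tV.
Proof.
split=> [i|i|i x|].
- by rewrite [LHS]daha_mulE; apply/daha_eqP/DCgenV.
- by rewrite [LHS]daha_mulE; apply/daha_eqP/DCgenVl.
- rewrite -[x]reprK [daha_t i + _]daha_addE [LHS]daha_mulE [RHS]daha_mulE.
  exact/daha_eqP/DCcentral.
- rewrite -daha_constE [daha_t 0 * _]daha_mulE [X in X * _]daha_mulE.
  by rewrite [LHS]daha_mulE; apply/daha_eqP/DCprod.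
Qed.

End DahaAlgebra.

Section DahaLift.
Variables (F : fieldType) (q : F) (q0 : q != 0) (A : algType F).
Variables (t s : 'I_4 -> A).
Hypotheses (ts : forall i, t i * s i = 1) (st : forall i, s i * t i = 1).
Hypothesis tc : forall i j, (t i + s i) * t j = t j * (t i + s i).
Hypothesis tp : t 0 * t 1 * t 2%:R * t 3%:R = (q^-1)%:A.

Lemma daha_lift :
  exists f : {lrmorphism daha q0 -> A},
    (forall i, f (daha_t q0 i) = t i) /\ (forall i, f (daha_tV q0 i) = s i).
Proof.
pose g (x : daha q0) : A := deval t s (repr x).
have gE x : g (\pi_(daha q0) x) = deval t s x.
  exact: deval_cong ts st tc tp _ _ (daha_repr q0 x).
have gD x y : g (x + y) = g x + g y.
  by rewrite -[x]reprK -[y]reprK [_ + _]daha_addE !gE.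
have gM x y : g (x * y) = g x * g y.
  by rewrite -[x]reprK -[y]reprK [_ * _]daha_mulE !gE.
have g1 : g 1 = 1 by rewrite [LHS](gE (DConst 1)) /= scale1r.
have gZ a x : g (a *: x) = a *: g x.
  by rewrite [LHS]gM (gE (DConst a)) /= -scalerAl mul1r.
have gB : zmod_morphism g.
  by move=> x y; rewrite gD -scaleN1r gZ scaleN1r.
pose gA := GRing.isZmodMorphism.Build _ _ g gB.
pose gR := GRing.isMonoidMorphism.Build _ _ g (g1, gM).
pose gL := GRing.isScalable.Build _ _ _ _ g gZ.
pose f : {lrmorphism daha q0 -> A} := HB.pack g gA gR gL.
by exists f; split=> i; apply: gE.
Qed.

End DahaLift.

(* The F-vector space underlying a module over an F-algebra A: the scalar a
   acts as a%:A. *)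
Definition restrict_scalars (F : fieldType) (A : algType F) (E : lmodType A) :
  Type := E.

Section RestrictScalars.
Variables (F : fieldType) (A : algType F) (E : lmodType A).
Local Notation V := (restrict_scalars E).

HB.instance Definition _ := GRing.Zmodule.copy V E.

Definition restrict_scale (a : F) (v : E) : E := a%:A *: v.

Fact restrict_scaleA a b v :
  restrict_scale a (restrict_scale b v) = restrict_scale (a * b) v.
Proof. by rewrite /restrict_scale scalerA -scalerAl mul1r scalerA. Qed.
Fact restrict_scale1 : left_id 1 restrict_scale.
Proof. by move=> v; rewrite /restrict_scale !scale1r. Qed.
Fact restrict_scaleDr : right_distributive restrict_scale +%R.
Proof. by move=> a u v; rewrite /restrict_scale scalerDr. Qed.
Fact restrict_scaleDl v : {morph restrict_scale^~ v : a b / a + b}.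
Proof. by move=> a b; rewrite /restrict_scale !scalerDl. Qed.

HB.instance Definition _ := GRing.Zmodule_isLmodule.Build F V
  restrict_scaleA restrict_scale1 restrict_scaleDr restrict_scaleDl.

(* Vector.axiom n V is the data of a linear isomorphism from V onto F^n. *)
Definition fdim_module (n : nat) (nV : Vector.axiom n V) : Type := V.

HB.instance Definition _ (n : nat) (nV : Vector.axiom n V) :=
  GRing.Lmodule.on (fdim_module nV).
HB.instance Definition _ (n : nat) (nV : Vector.axiom n V) :=
  Lmodule_hasFinDim.Build F (fdim_module nV) nV.

End RestrictScalars.

(* Main.v *)
Require Import Defs.
From HB Require Import structures.
From mathcomp Require Import all_boot all_algebra.
From mathcomp Require Import ring.

(** The formulas of condition (i) make sense for every natural number [i] and
    define four operators on the space with basis [v_0, v_1, ...].  The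
    hypothesis [k0 ^+ 2 = q ^- d.+1] is what cuts this space down to dimension
    [d.+1]: it kills the coefficient of [v_d] in [t0 v_(d+1)] and in
    [t1 v_(d+1)], while [t2] and [t3] have no such coefficient because [d] is
    odd.  Hence the span of the [v_i] with [i > d] is stable, and the quotient
    by it is the module, with no border cases left: putting [v_i = 0] for
    [i > d], the generic formulas hold for all [i] (lemmas [t0_mxE] to
    [t3_mxE]).  The special formulas for [v_0] and [v_d] are instances of them.

    It remains to see that these operators satisfy the defining relations.
    - Each satisfies [t ^ 2 = (k + k^-1) t - 1].  Indeed [t0] preserves the
      span of [v_(2m-1)] and [v_(2m)], and [t2] that of [v_(2m)] and
      [v_(2m+1)], and the two-by-two blocks have trace [k + k^-1] and
      determinant 1 ([v_0] and [v_d] are eigenvectors of [t0]); [t1] (resp.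
      [t3]) acts as a scalar on the span of the odd (resp. even) basis vectors
      and as the inverse scalar on the quotient by this span.  So [t] is invertible with inverse
      [(k + k^-1) - t], and [t + t^-1] is a scalar: this gives at once the
      centrality relations and condition (ii).
    - The relation [t0 t1 t2 t3 = q^-1] is equivalent to
      [t2 t3 = q^-1 t1^-1 t0^-1] (lemma [t23_prod]), in which both sides are
      now explicit sums of products of at most two of the operators.

    Both are finite computations on the vectors [v_i].  The universal property
    [daha_lift] turns the four matrices into a representation, hence into a
    module of column vectors. *)

Set Implicit Arguments.
Unset Strict Implicit.
Unset Printing Implicit Defensive.

Import GRing.Theory.
Local Open Scope ring_scope.

(** * Column vectors as a module over a matrix algebra *)

(** The representation is a parameter of the type so that the module structure
    of [col_module rho] can be found from the type alone. *)
Definition col_module (F : fieldType) (A : algType F) (n : nat)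
  (rho : {lrmorphism A -> 'M[F]_n.+1}) : Type := 'cV[F]_n.+1.

Section ColumnModule.
Variables (F : fieldType) (A : algType F) (n : nat).
Variable rho : {lrmorphism A -> 'M[F]_n.+1}.

Local Notation E := (col_module rho).

HB.instance Definition _ := GRing.Zmodule.copy E 'cV[F]_n.+1.

Definition col_act (a : A) (x : E) : E := rho a *m x.

Fact col_actA a b x : col_act a (col_act b x) = col_act (a * b) x.
Proof. by rewrite /col_act rmorphM mulmxA. Qed.
Fact col_act1 : left_id 1 col_act.
Proof. by move=> x; rewrite /col_act rmorph1 mul1mx. Qed.
Fact col_actDr : right_distributive col_act +%R.
Proof. by move=> a x y; rewrite /col_act mulmxDr. Qed.
Fact col_actDl x : {morph col_act^~ x : a b / a + b}.
Proof. by move=> a b; rewrite /col_act rmorphD mulmxDl. Qed.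

HB.instance Definition _ := GRing.Zmodule_isLmodule.Build A E
  col_actA col_act1 col_actDr col_actDl.

Lemma col_actE (a : A) (x : E) : a *: x = rho a *m x :> 'cV[F]_n.+1.
Proof. by []. Qed.

Lemma col_scaleE (a : F) (x : E) :
  a%:A *: x = a *: (x : 'cV[F]_n.+1) :> 'cV[F]_n.+1.
Proof. by rewrite col_actE linearZ rmorph1 -scalemxAl mul1mx. Qed.

(** Restricting scalars to the ground field gives back the usual vector space,
    so transposition onto row vectors is the required isomorphism. *)
Lemma col_vector_axiom : Vector.axiom n.+1 (restrict_scalars E).
Proof.
exists (fun x : E => (x : 'cV[F]_n.+1)^T).
  move=> a x y.
  have -> : a *: x + y = a *: (x : 'cV[F]_n.+1) + (y : 'cV[F]_n.+1) :> 'cV[F]_n.+1.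
    by congr (_ + _); exact: col_scaleE.
  by rewrite linearP.
by exists (fun y : 'rV[F]_n.+1 => y^T) => x; rewrite trmxK.
Qed.

End ColumnModule.

(** * Matrices given by the images of the basis vectors *)

Section StandardColumns.
Variables (F : fieldType) (d : nat).

(** Indexing by [nat] instead of ['I_d.+1] makes the vector zero for [i > d],
    which is the quotient by the span of the vectors beyond [v_d]. *)
Definition std_col (i : nat) : 'cV[F]_d.+1 := \col_r (r == i :> nat)%:R.

Lemma std_col_eq0 i : (d < i)%N -> std_col i = 0.
Proof.
move=> di; apply/matrixP=> r c; rewrite !mxE.
by rewrite ltn_eqF //; apply: leq_trans (ltn_ord r) di.
Qed.

Lemma std_col_delta (j : 'I_d.+1) : std_col j = delta_mx j 0.
Proof. by apply/matrixP=> r c; rewrite !mxE ord1 andbT. Qed.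

Lemma col_sum_std (x : 'cV[F]_d.+1) : x = \sum_j x j 0 *: std_col j.
Proof.
rewrite [LHS]matrix_sum_delta; apply: eq_bigr => j _.
by rewrite big_ord1 std_col_delta.
Qed.

Lemma mx_eq_std (M N : 'M[F]_d.+1) :
  (forall i, M *m std_col i = N *m std_col i) -> M = N.
Proof.
move=> MN; apply/matrixP=> r j; have /matrixP/(_ r 0) := MN j.
by rewrite !std_col_delta -!colE !mxE.
Qed.

Definition mx_of_cols (w : nat -> 'cV[F]_d.+1) : 'M[F]_d.+1 :=
  \matrix_(r, j) w j r 0.

(** Beyond the last column the matrix carries no information, hence the
    hypothesis that [w] vanishes there. *)
Lemma mx_of_colsE w i :
  ((d < i)%N -> w i = 0) -> mx_of_cols w *m std_col i = w i.
Proof.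
move=> w0; case: (ltnP d i) => di; first by rewrite w0 // std_col_eq0 // mulmx0.
rewrite (std_col_delta (Ordinal (di : (i < d.+1)%N))) -colE.
by apply/matrixP=> r c; rewrite !mxE ord1.
Qed.

End StandardColumns.

(** * The four operators *)

Section Generators.
Variables (F : fieldType) (q : F) (d : nat) (k0 k1 k2 k3 : F).
Hypothesis d_odd : odd d.
Hypotheses (q0 : q != 0) (k0_neq0 : k0 != 0) (k1_neq0 : k1 != 0).
Hypotheses (k2_neq0 : k2 != 0) (k3_neq0 : k3 != 0).
Hypothesis k0q : k0 ^+ 2 = q ^- d.+1.
Local Notation e := (@std_col F d).

(** At [i = 0] the term [e i.-1] is [e 0] itself, with coefficient 0 because of
    the factor [1 - q ^+ i]; the same holds in [t1_col]. *)
Definition t0_col (i : nat) : 'cV[F]_d.+1 :=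
  if odd i then (k0^-1 * q ^- i.+1) *: (e i - e i.+1)
  else (k0^-1 * q ^- i * (1 - q ^+ i) * (1 - k0 ^+ 2 * q ^+ i)) *: e i.-1
       + (k0 + k0^-1 - k0^-1 * q ^- i) *: e i.

Definition t1_col (i : nat) : 'cV[F]_d.+1 :=
  if odd i then k1^-1 *: e i
  else (- k1 * (1 - q ^+ i) * (1 - k0 ^+ 2 * q ^+ i)) *: e i.-1
       + k1 *: e i + k1^-1 *: e i.+1.

Definition t2_col (i : nat) : 'cV[F]_d.+1 :=
  if odd i then
    ((k0 * k1 * k3 * q ^+ i - k2) * (k0 * k1 * k3 * q ^+ i - k2^-1)
       / (k0 * k1 * k3 * q ^+ i)) *: e i.-1
    + (k2 + k2^-1 - k0^-1 * k1^-1 * k3^-1 * q ^- i) *: e i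
  else (k0^-1 * k1^-1 * k3^-1 * q ^- i.+1) *: (e i - e i.+1).

Definition t3_col (i : nat) : 'cV[F]_d.+1 :=
  if odd i then
    (- k3^-1 * (k0 * k1 * k3 * q ^+ i - k2) * (k0 * k1 * k3 * q ^+ i - k2^-1))
      *: e i.-1
    + k3^-1 *: e i + k3 *: e i.+1
  else k3 *: e i.

Definition t0_mx := mx_of_cols t0_col.
Definition t1_mx := mx_of_cols t1_col.
Definition t2_mx := mx_of_cols t2_col.
Definition t3_mx := mx_of_cols t3_col.

Lemma k0q_eq0 : 1 - k0 ^+ 2 * q ^+ d.+1 = 0.
Proof. by rewrite k0q mulVf ?subrr // expf_neq0. Qed.

(** The only border index is [i = d.+1], which is even. *)
Lemma pred_std_col_eq0 i : (d < i)%N -> odd i -> e i.-1 = 0.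
Proof.
case: i => // i; rewrite ltnS leq_eqVlt => /predU1P[<- /=|di _].
  by rewrite d_odd.
exact: std_col_eq0.
Qed.

(** This is where [k0] being tied to [d] makes the span of the [e i] with
    [i > d] stable under the first two operators. *)
Lemma border_std_col_eq0 i : (d < i)%N -> (1 - k0 ^+ 2 * q ^+ i) *: e i.-1 = 0.
Proof.
case: i => // i; rewrite ltnS leq_eqVlt => /predU1P[<-|di].
  by rewrite k0q_eq0 scale0r.
by rewrite [e _]std_col_eq0 ?scaler0.
Qed.

(** In this lemma and the next three, what has to be seen is that the column
    vanishes for [i > d]; its term in [e i.-1] is then covered by one of the
    two preceding lemmas. *)
Lemma t0_mxE i : t0_mx *m e i = t0_col i.
Proof.
apply: mx_of_colsE => di; rewrite /t0_col [e i]std_col_eq0 //.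
rewrite [e i.+1]std_col_eq0 ?(leqW di) //.
rewrite -[(_ * (1 - _ ^+ 2 * _)) *: _]scalerA border_std_col_eq0 //.
by rewrite subrr !scaler0 addr0 if_same.
Qed.

Lemma t1_mxE i : t1_mx *m e i = t1_col i.
Proof.
apply: mx_of_colsE => di; rewrite /t1_col [e i]std_col_eq0 //.
rewrite [e i.+1]std_col_eq0 ?(leqW di) //.
rewrite -[(_ * (1 - _ ^+ 2 * _)) *: _]scalerA border_std_col_eq0 //.
by rewrite !scaler0 !addr0 if_same.
Qed.

Lemma t2_mxE i : t2_mx *m e i = t2_col i.
Proof.
apply: mx_of_colsE => di; rewrite /t2_col [e i]std_col_eq0 //.
rewrite [e i.+1]std_col_eq0 ?(leqW di) //.
by case: ifP => oi; rewrite ?pred_std_col_eq0 ?subrr ?scaler0 ?addr0.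
Qed.

Lemma t3_mxE i : t3_mx *m e i = t3_col i.
Proof.
apply: mx_of_colsE => di; rewrite /t3_col [e i]std_col_eq0 //.
rewrite [e i.+1]std_col_eq0 ?(leqW di) //.
by case: ifP => oi; rewrite ?pred_std_col_eq0 ?scaler0 ?addr0.
Qed.

(** * The defining relations *)

(** Zero is set apart from the other even numbers, because of the meaning of
    [i.-1] there. *)
Lemma nat_parity_ind (P : nat -> Prop) :
  P 0%N -> (forall m, P m.*2.+1) -> (forall m, P m.*2.+2) -> forall i, P i.
Proof.
move=> P0 Po Pe i; rewrite -(odd_double_half i).
by case: (odd i) => //; case: i./2.
Qed.

(** Proves an equality of polynomials in the four matrices by evaluating both
    sides at each basis vector, which leaves linear combinations of neighbouring
    basis vectors.  The coefficients match identically: the entries of the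
    basis vectors and the power [q ^+ m.*2] are generalized into
    indeterminates, and the equality becomes one of rational functions. *)
Ltac check_on_std :=
  apply: mx_eq_std; elim/nat_parity_ind => [|m|m];
  repeat (progress (
    rewrite -?mulmxA ?(mulmxDl, mulmxBl, mulNmx, mul1mx, mul_scalar_mx) -?scalemxAl;
    rewrite ?(t0_mxE, t1_mxE, t2_mxE, t3_mxE) /t0_col /t1_col /t2_col /t3_col;
    rewrite /= ?odd_double /= ?(mulmxDr, mulmxBr, mulmxN) -?scalemxAr));
  rewrite ?(exprS q) ?(expr0 q);
  apply/matrixP => r c;
  repeat match goal with |- context [@std_col F d ?i] =>
    move: (@std_col F d i) => ? end;
  rewrite !mxE;
  try match goal with |- context [q ^+ ?n] =>
    have := expf_neq0 n q0; move: (q ^+ n) => ? ? end;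
  field; rewrite ?oner_eq0; do ?[apply/andP; split].

Lemma t0_quad : t0_mx *m t0_mx = (k0 + k0^-1) *: t0_mx - 1%:M.
Proof. by check_on_std. Qed.

Lemma t1_quad : t1_mx *m t1_mx = (k1 + k1^-1) *: t1_mx - 1%:M.
Proof. by check_on_std. Qed.

Lemma t2_quad : t2_mx *m t2_mx = (k2 + k2^-1) *: t2_mx - 1%:M.
Proof. by check_on_std. Qed.

Lemma t3_quad : t3_mx *m t3_mx = (k3 + k3^-1) *: t3_mx - 1%:M.
Proof. by check_on_std. Qed.

(** The form [t2 t3 = q^-1 t1^-1 t0^-1] of the product relation, with the
    inverses given by the quadratic relations.  Unlike [t0 t1 t2 t3], neither
    side moves an odd basis vector below its predecessor, so that the three
    cases of [nat_parity_ind] suffice. *)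
Lemma t23_prod : t2_mx *m t3_mx =
  q^-1 *: (((k1 + k1^-1)%:M - t1_mx) *m ((k0 + k0^-1)%:M - t0_mx)).
Proof. by check_on_std. Qed.

(** * The representation *)

Definition gen_mx (i : 'I_4) : 'M[F]_d.+1 :=
  tnth [tuple t0_mx; t1_mx; t2_mx; t3_mx] i.
Definition gen_trace (i : 'I_4) : F :=
  tnth [tuple k0 + k0^-1; k1 + k1^-1; k2 + k2^-1; k3 + k3^-1] i.
Definition gen_inv_mx (i : 'I_4) : 'M[F]_d.+1 := (gen_trace i)%:M - gen_mx i.

Lemma gen_quad i : gen_mx i *m gen_mx i = gen_trace i *: gen_mx i - 1%:M.
Proof.
case: i => -[|[|[|[|//]]]] i; rewrite /gen_mx /gen_trace !(tnth_nth 0) /=.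
- exact: t0_quad.
- exact: t1_quad.
- exact: t2_quad.
- exact: t3_quad.
Qed.

Lemma gen_mxV i : gen_mx i *m gen_inv_mx i = 1%:M.
Proof. by rewrite mulmxBr gen_quad mul_mx_scalar subKr. Qed.

Lemma gen_mxVl i : gen_inv_mx i *m gen_mx i = 1%:M.
Proof. by rewrite mulmxBl gen_quad mul_scalar_mx subKr. Qed.

Lemma gen_mx_prod :
  gen_mx 0 *m gen_mx 1 *m gen_mx 2%:R *m gen_mx 3%:R = q^-1 *: 1%:M.
Proof.
have t23 : gen_mx 2%:R *m gen_mx 3%:R = q^-1 *: (gen_inv_mx 1 *m gen_inv_mx 0).
  exact: t23_prod.
rewrite -mulmxA t23 -scalemxAr -mulmxA (mulmxA (gen_mx 1)) gen_mxV mul1mx.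
by rewrite gen_mxV.
Qed.

Lemma gen_rep : exists rho : {lrmorphism daha q0 -> 'M[F]_d.+1},
  (forall i, rho (daha_t q0 i) = gen_mx i)
  /\ (forall i, rho (daha_tV q0 i) = gen_inv_mx i).
Proof.
apply: daha_lift; [exact: gen_mxV | exact: gen_mxVl | | ].
  (* [t + t^-1] is a scalar matrix. *)
  by move=> i j; rewrite /gen_inv_mx addrC subrK; exact/esym/scalar_mxC.
exact: gen_mx_prod.
Qed.

End Generators.

(** * The module *)

Theorem proposition2p1 (F : fieldType) (q : F) (q0 : q != 0)
  (d : nat) (d_ge1 : (1 <= d)%N) (d_odd : odd d)
  (k0 k1 k2 k3 : F)
  (k0_neq0 : k0 != 0) (k1_neq0 : k1 != 0) (k2_neq0 : k2 != 0) (k3_neq0 : k3 != 0)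
  (k0q : k0 ^+ 2 = q ^- d.+1) :
  let t0 := daha_t q0 0 in
  let t1 := daha_t q0 1 in
  let t2 := daha_t q0 2%:R in
  let t3 := daha_t q0 3%:R in
  exists (E : lmodType (daha q0)) (dimE : Vector.axiom d.+1 (restrict_scalars E)),
    (exists v : d.+1.-tuple E,
      [/\ basis_of fullv (v : seq (fdim_module dimE)),
          [/\ forall i : nat, ~~ odd i -> (2 <= i <= d - 1)%N ->
                t0 *: v`_i =
                  (k0^-1 * q ^- i * (1 - q ^+ i) * (1 - k0 ^+ 2 * q ^+ i))%:A
                    *: v`_(i - 1)
                  + (k0 + k0^-1 - k0^-1 * q ^- i)%:A *: v`_i,
              forall i : nat, odd i -> (1 <= i <= d - 2)%N ->
                t0 *: v`_i = (k0^-1 * q ^- i.+1)%:A *: (v`_i - v`_i.+1),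
              t0 *: v`_0 = k0%:A *: v`_0
            & t0 *: v`_d = k0%:A *: v`_d],
          [/\ forall i : nat, ~~ odd i -> (2 <= i <= d - 1)%N ->
                t1 *: v`_i =
                  (- k1 * (1 - q ^+ i) * (1 - k0 ^+ 2 * q ^+ i))%:A
                    *: v`_(i - 1)
                  + k1%:A *: v`_i + (k1^-1)%:A *: v`_i.+1,
              forall i : nat, odd i -> (1 <= i <= d)%N ->
                t1 *: v`_i = (k1^-1)%:A *: v`_i
            & t1 *: v`_0 = k1%:A *: v`_0 + (k1^-1)%:A *: v`_1],
          (forall i : nat, ~~ odd i -> (0 <= i <= d - 1)%N ->
                t2 *: v`_i =
                  (k0^-1 * k1^-1 * k3^-1 * q ^- i.+1)%:A *: (v`_i - v`_i.+1))
          /\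
          (forall i : nat, odd i -> (1 <= i <= d)%N ->
                t2 *: v`_i =
                  ((k0 * k1 * k3 * q ^+ i - k2) * (k0 * k1 * k3 * q ^+ i - k2^-1)
                     / (k0 * k1 * k3 * q ^+ i))%:A *: v`_(i - 1)
                  + (k2 + k2^-1 - k0^-1 * k1^-1 * k3^-1 * q ^- i)%:A *: v`_i)
        & [/\ forall i : nat, ~~ odd i -> (0 <= i <= d - 1)%N ->
                t3 *: v`_i = k3%:A *: v`_i,
              forall i : nat, odd i -> (1 <= i <= d - 2)%N ->
                t3 *: v`_i =
                  (- k3^-1 * (k0 * k1 * k3 * q ^+ i - k2)
                     * (k0 * k1 * k3 * q ^+ i - k2^-1))%:A *: v`_(i - 1)
                  + (k3^-1)%:A *: v`_i + k3%:A *: v`_i.+1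
            & t3 *: v`_d =
                (- k3^-1 * (k0 * k1 * k3 * q ^+ d - k2)
                   * (k0 * k1 * k3 * q ^+ d - k2^-1))%:A *: v`_(d - 1)
                + (k3^-1)%:A *: v`_d]])
    /\
    [/\ forall x : E, daha_c q0 0 *: x = (k0 + k0^-1)%:A *: x,
        forall x : E, daha_c q0 1 *: x = (k1 + k1^-1)%:A *: x,
        forall x : E, daha_c q0 2%:R *: x = (k2 + k2^-1)%:A *: x
      & forall x : E, daha_c q0 3%:R *: x = (k3 + k3^-1)%:A *: x].
Proof.
have [rho [rho_t rho_tV]] := gen_rep d_odd q0 k0_neq0 k1_neq0 k2_neq0 k3_neq0 k0q.
pose E : lmodType (daha q0) := col_module rho.
move=> t0 t1 t2 t3; exists E, (col_vector_axiom rho); split; last first.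
  have cE i (x : E) :
    daha_c q0 i *: x = (gen_trace k0 k1 k2 k3 i)%:A *: x.
    have rho_c : rho (daha_c q0 i) = rho (daha_t q0 i) + rho (daha_tV q0 i).
      exact: rmorphD.
    rewrite col_scaleE col_actE rho_c rho_t rho_tV /gen_inv_mx.
    by rewrite addrC subrK mul_scalar_mx.
  by split=> x; exact: cE.
pose v : d.+1.-tuple E := [tuple (@std_col F d i : E) | i < d.+1].
have vE i : v`_i = @std_col F d i.
  have [id|di] := leqP i d; last by rewrite std_col_eq0 // nth_default ?size_tuple.
  rewrite (_ : i = Ordinal (id : (i < d.+1)%N)) //.
  by rewrite -tnth_nth tnth_mktuple.
have tE i j : daha_t q0 i *: v`_j = gen_mx q d k0 k1 k2 k3 i *m @std_col F d j.
  by rewrite col_actE rho_t vE.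
exists v; split.
- rewrite basisEdim size_tuple dimvf leqnn andbT.
  apply/subvP=> x _.
  pose V := fdim_module (col_vector_axiom rho).
  have -> : x = \sum_(j < d.+1) (x : 'cV[F]_d.+1) j 0 *: (v`_j : V).
    apply: (etrans (col_sum_std x)); apply: eq_bigr => j _; rewrite -vE.
    exact/esym/col_scaleE.
  apply: rpred_sum => j _; apply: rpredZ; apply: memv_span.
  by apply: mem_nth; rewrite size_tuple.
- split=> [i oi _|i oi _||]; rewrite tE t0_mxE // /t0_col ?oi ?d_odd.
  + by rewrite (negPf oi) !col_scaleE !vE subn1.
  + by rewrite col_scaleE !vE.
  + rewrite /= col_scaleE vE expr0 subrr mulr0 mul0r scale0r add0r.
    by rewrite invr1 mulr1 addrK.
  (* [v_(d+1) = 0] and [k0^-1 q^-(d+1) = k0]. *)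
  + by rewrite col_scaleE vE -k0q expr2 mulKf // (std_col_eq0 _ (ltnSn d)) subr0.
- split=> [i oi _|i oi _|]; rewrite tE t1_mxE // /t1_col ?oi.
  + by rewrite (negPf oi) !col_scaleE !vE subn1.
  + by rewrite col_scaleE vE.
  + by rewrite /= !col_scaleE !vE expr0 subrr mulr0 mul0r scale0r add0r.
- split=> i oi _; rewrite tE t2_mxE // /t2_col ?oi.
  + by rewrite (negPf oi) col_scaleE !vE.
  + by rewrite !col_scaleE !vE subn1.
- split=> [i oi _|i oi _|]; rewrite tE t3_mxE // /t3_col ?oi ?d_odd.
  + by rewrite (negPf oi) col_scaleE vE.
  + by rewrite !col_scaleE !vE subn1.
  + by rewrite !col_scaleE !vE subn1 (std_col_eq0 _ (ltnSn d)) scaler0 addr0.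
Qed.
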